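(* Let $\gamma>0$ and real constants $c_u,c_l$ be fixed, and for $\delta\in(0,1)$ let $\rho_{\gamma}(\delta)=\dfrac{1}{\gamma\log(\delta^{-1})}$. Define $$\widetilde{\mathcal{U}}^{\gamma}(\delta,\rho_{\gamma}(\delta))=\sqrt{2\rho_{\gamma}(\delta)\log\left(\frac{1}{\delta^2\rho_{\gamma}^3(\delta)}\right)+6\rho_{\gamma}(\delta)}+c_u\left[2\rho_{\gamma}(\delta)\log\left(\frac{1}{\delta^2\rho_{\gamma}^3(\delta)}\right)+6\rho_{\gamma}(\delta)\right],$$ $$\widetilde{\mathcal{L}}^{\gamma}(\delta,\rho_{\gamma}(\delta))=\sqrt{2\rho_{\gamma}(\delta)\log\left(\frac{1}{\delta^2\rho_{\gamma}^3(\delta)}\right)+6\rho_{\gamma}(\delta)}-c_l\left[2\rho_{\gamma}(\delta)\log\left(\frac{1}{\delta^2\rho_{\gamma}^3(\delta)}\right)+6\rho_{\gamma}(\delta)\right].$$ Then $$\lim_{\delta\to0}\widetilde{\mathcal{U}}^{\gamma}(\delta,\rho_{\gamma}(\delta))=\frac{2}{\sqrt{\gamma}}+\frac{4}{\gamma}c_u,\qquad \lim_{\delta\to0}\widetilde{\mathcal{L}}^{\gamma}(\delta,\rho_{\gamma}(\delta))=\frac{2}{\sqrt{\gamma}}-\frac{4}{\gamma}c_l.$$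
   Context: The superscript $\gamma$ in $\widetilde{\mathcal{U}}^{\gamma},\widetilde{\mathcal{L}}^{\gamma}$ is only a label, not an exponent; $\rho_\gamma^3(\delta)$ means $(\rho_\gamma(\delta))^3$. $\log$ is the natural logarithm. The limit $\delta\to0$ is through positive $\delta$ (the expressions are well defined for all sufficiently small $\delta>0$). *)

(* Defs.v *)
From Stdlib Require Import Reals.
From Coquelicot Require Import Coquelicot.

(* Standard library reals, with Coquelicot for limits.  [ln], [sqrt] and [/] are
   total; for all sufficiently small delta > 0 their arguments below are
   positive, so the conventions outside the natural domains play no role. *)

Open Scope R_scope.

Definition rho (gamma delta : R) : R := 1 / (gamma * ln (/ delta)).

Definition bracket (delta r : R) : R :=
  2 * r * ln (1 / (delta ^ 2 * r ^ 3)) + 6 * r.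

(* The label gamma carried by the two bounds enters only through the value
   [r = rho gamma delta] at which they are evaluated. *)
Definition U_tilde (c_u delta r : R) : R :=
  sqrt (bracket delta r) + c_u * bracket delta r.

Definition L_tilde (c_l delta r : R) : R :=
  sqrt (bracket delta r) - c_l * bracket delta r.

(* Main.v *)
Require Import Defs.
From Stdlib Require Import Reals Lra.
From Coquelicot Require Import Coquelicot.

(** Both bounds have the form [sqrt b + c * b] with the same quantity [b],
    namely [bracket] at [r = rho gamma delta], so everything rests on the limit
    of [b].  In the variable [s = gamma * ln (/ delta)], which tends to
    infinity as [delta] tends to [0] from the right, one has [r = 1 / s] and
    [ln (1 / (delta ^ 2 * r ^ 3)) = 2 * s / gamma + 3 * ln s], hence the exact
    formula [b = 4 / gamma + 6 * (ln s / s) + 6 * / s] ([bracket_rho]).  The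
    corrections vanish since [ln s] is negligible against [s], so [b] tends to
    [4 / gamma] ([bracket_rho_lim]); continuity of [x |-> sqrt x + c * x] at
    that point gives the two limits, with [c = c_u] and [c = - c_l]. *)

Open Scope R_scope.

(** Taking [delta < 1] makes [s] positive, which is what allows the logarithm
    of the product to be split. *)
Lemma bracket_rho (gamma delta : R) :
  0 < gamma -> 0 < delta < 1 ->
  let s := gamma * ln (/ delta) in
  bracket delta (rho gamma delta) = 4 / gamma + 6 * (ln s / s) + 6 * / s.
Proof.
intros hgamma hdelta s.
assert (hlog : 0 < - ln delta).
{ pose proof (ln_increasing delta 1 (proj1 hdelta) (proj2 hdelta)) as hlt.
  rewrite ln_1 in hlt; lra. }
assert (hs_eq : s = gamma * - ln delta).
{ unfold s; rewrite ln_Rinv by lra; reflexivity. }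
assert (hs : 0 < s) by (rewrite hs_eq; apply Rmult_lt_0_compat; assumption).
unfold bracket, rho; fold s.
replace (1 / (delta ^ 2 * (1 / s) ^ 3)) with ((/ delta) ^ 2 * s ^ 3)
  by (field; lra).
assert (hinv : 0 < / delta) by (apply Rinv_0_lt_compat; lra).
rewrite ln_mult by (apply pow_lt; assumption).
rewrite !ln_pow by assumption.
rewrite ln_Rinv by lra.
replace (- ln delta) with (s / gamma) by (rewrite hs_eq; field; lra).
simpl INR; field; lra.
Qed.

Lemma scaled_log_inv_lim (gamma : R) :
  0 < gamma ->
  filterlim (fun delta => gamma * ln (/ delta))
    (at_right 0) (Rbar_locally p_infty).
Proof.
intros hgamma.
apply (filterlim_comp _ _ _ (fun delta => ln (/ delta)) (fun x => gamma * x)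
         _ (Rbar_locally p_infty)).
- apply (filterlim_comp _ _ _ Rinv ln _ (Rbar_locally p_infty)).
  + exact filterlim_Rinv_0_right.
  + exact is_lim_ln_p.
- intros P [M hM].
  exists (M / gamma); intros x hx.
  apply hM.
  apply (Rmult_lt_compat_l gamma) in hx; [|assumption].
  replace (gamma * (M / gamma)) with M in hx by (field; lra).
  exact hx.
Qed.

Lemma bracket_rho_lim (gamma : R) :
  0 < gamma ->
  filterlim (fun delta => bracket delta (rho gamma delta))
    (at_right 0) (locally (4 / gamma)).
Proof.
intros hgamma.
set (f := fun s => 4 / gamma + 6 * (ln s / s) + 6 * / s).
assert (hf : is_lim f p_infty (4 / gamma)).
{ replace (4 / gamma) with (4 / gamma + 6 * 0 + 6 * 0) by ring.
  apply is_lim_plus'; [apply is_lim_plus'|].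
  - apply is_lim_const.
  - exact (is_lim_scal_l _ 6 _ _ is_lim_div_ln_p).
  - refine (is_lim_scal_l _ 6 _ 0 _).
    exact (is_lim_inv _ _ _ (is_lim_id p_infty) ltac:(discriminate)). }
apply (filterlim_ext_loc (fun delta => f (gamma * ln (/ delta)))).
- exists (mkposreal 1 Rlt_0_1); intros delta hball hpos.
  symmetry; apply bracket_rho; [assumption|].
  apply Rabs_def2 in hball.
  unfold minus, plus, opp in hball; simpl in hball; lra.
- exact (filterlim_comp _ _ _ _ f _ _ _ (scaled_log_inv_lim gamma hgamma) hf).
Qed.

(** The sign of [c] is left free, so that one limit serves both bounds; it
    follows from the continuity of [x |-> sqrt x + c * x] at [4 / gamma],
    where [sqrt (4 / gamma) = 2 / sqrt gamma]. *)
Lemma sqrt_plus_scal_bracket_lim (gamma c : R) :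
  0 < gamma ->
  filterlim
    (fun delta => sqrt (bracket delta (rho gamma delta))
                  + c * bracket delta (rho gamma delta))
    (at_right 0) (locally (2 / sqrt gamma + 4 / gamma * c)).
Proof.
intros hgamma.
replace (2 / sqrt gamma + 4 / gamma * c)
  with (sqrt (4 / gamma) + c * (4 / gamma)).
2:{ rewrite sqrt_div by lra.
    replace 4 with (2 * 2) at 1 by ring.
    rewrite sqrt_square by lra; ring. }
apply (filterlim_comp _ _ _ (fun delta => bracket delta (rho gamma delta))
         (fun b => sqrt b + c * b) _ (locally (4 / gamma))).
- exact (bracket_rho_lim gamma hgamma).
- apply (continuous_plus sqrt (fun b => c * b)).
  + apply continuous_sqrt.
  + apply (continuous_scal_r c (fun b : R => b)), continuous_id.
Qed.

Theorem corollary5 (gamma c_u c_l : R) (hgamma : 0 < gamma) :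
  filterlim (fun delta : R => U_tilde c_u delta (rho gamma delta))
    (at_right 0) (locally (2 / sqrt gamma + 4 / gamma * c_u)) /\
  filterlim (fun delta : R => L_tilde c_l delta (rho gamma delta))
    (at_right 0) (locally (2 / sqrt gamma - 4 / gamma * c_l)).
Proof.
split.
- exact (sqrt_plus_scal_bracket_lim gamma c_u hgamma).
- replace (2 / sqrt gamma - 4 / gamma * c_l)
    with (2 / sqrt gamma + 4 / gamma * - c_l) by ring.
  refine (filterlim_ext _ _ _ (sqrt_plus_scal_bracket_lim gamma (- c_l) hgamma)).
  intros delta; unfold L_tilde; ring.
Qed.
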